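(* Let $G=\mathbb{Z}_{d_1}\times\cdots\times\mathbb{Z}_{d_r}$ be a finite abelian group with $N=|G|$ and let $\Gamma=\mathrm{Cay}(G;S_{i,j}\mid 1\le i,j\le n)$ be an $n$-Cayley digraph over $G$. Set $$H=\{\sigma\in\mathrm{Gal}(\mathbb{Q}(\omega_N)|\mathbb{Q}):\ \beta_k\langle\Delta\rangle(g)=\beta_k\langle\Delta\rangle(\eta_\sigma(g))\ \text{for all }k\in[n],\ g\in G\}$$ and $K_0=\mathrm{Inv}(H)$. Let $\{H_j:j\in J\}$ be the set of distinct orbits of $G$ under $H$ acting by $\sigma\cdot g=\eta_\sigma(g)$, and let $\{v^{(j)}:j\in J\}$ be a set of representatives, $v^{(j)}\in H_j$. Then the splitting field of $\Gamma$ is $$K_0\Big(\bigcup_{j\in J}\mathcal{R}\big(\mathcal{P}\langle\widetilde{\Delta}(\chi_{v^{(j)}})\rangle\big)\Big),$$ and the algebraic degree of $\Gamma$ satisfies $$\frac{\phi(N)}{|H|}\le \deg(\Gamma)\le (n!)^{|J|}\frac{\phi(N)}{|H|}.$$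
   Context: $G$ is written additively; $[n]=\{1,\dots,n\}$; $\omega_m=e^{2\pi\iota/m}$; $N=d_1\cdots d_r$; $\phi$ is Euler's totient function. For subsets $S_{i,j}\subseteq G$, the $n$-Cayley digraph $\mathrm{Cay}(G;S_{i,j}\mid 1\le i,j\le n)$ has vertex set $G\times[n]$ and an arc from $(g,i)$ to $(s+g,j)$ for every $g\in G$, $s\in S_{i,j}$. The adjacency matrix has $(u,w)$ entry equal to the number of arcs from $u$ to $w$. The splitting field of a digraph is the splitting field over $\mathbb{Q}$ (inside $\mathbb{C}$) of the characteristic polynomial of its adjacency matrix, and its algebraic degree $\deg(\Gamma)$ is the degree of this field over $\mathbb{Q}$. $\mathbb{Q}[G]$ is the ring of functions $G\to\mathbb{Q}$ with pointwise addition and convolution $(a*b)(g)=\sum_h a(g-h)b(h)$; $\delta_S$ is the indicator of $S$ and $-S=\{-s:s\in S\}$. $\Delta\in M_n(\mathbb{Q}[G])$ has $(i,j)$ entry $\delta_{-S_{j,i}}$. For a matrix $A$ over a commutative ring, $\beta_k\langle A\rangle$ is the sum of determinants of all $k\times k$ principal submatrices. For $\sigma\in\mathrm{Gal}(\mathbb{Q}(\omega_N)|\mathbb{Q})$, $l_\sigma\in\mathbb{Z}_N^*$ is given by $\sigma(\omega_N)=\omega_N^{l_\sigma}$ and $\eta_\sigma(g_1,\dots,g_r)=(l_\sigma g_1,\dots,l_\sigma g_r)$ (coordinate $i$ modulo $d_i$). For a subgroup $H$ of $\mathrm{Gal}(\mathbb{Q}(\omega_N)|\mathbb{Q})$, $\mathrm{Inv}(H)=\{x\in\mathbb{Q}(\omega_N):\sigma(x)=x\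 \forall\sigma\in H\}$. For $v\in G$, $\chi_v(g_1,\dots,g_r)=\prod_{i=1}^r\omega_{d_i}^{v_ig_i}$. For $a\in\mathbb{C}[G]$, $\widehat a(\chi)=\sum_g a(g)\overline{\chi(g)}$, and $\widetilde{\Delta}(\chi)$ is the complex $n\times n$ matrix with $(i,j)$ entry $\widehat{\delta_{-S_{j,i}}}(\chi)=\sum_{g\in S_{j,i}}\chi(g)$. For a complex matrix $M$ of order $n$, $\mathcal{P}\langle M\rangle(x)=\det(xI_n-M)$, and for a polynomial $f$, $\mathcal{R}(f)$ is the set of its distinct complex roots. *)

(* Defs.v *)
From HB Require Import structures.
From mathcomp Require Import all_boot all_order all_fingroup all_algebra all_field.
From mathcomp Require Import ring lra.

Set Implicit Arguments.
Unset Strict Implicit.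
Unset Printing Implicit Defensive.

Import Order.TTheory GRing.Theory Num.Theory.
Local Open Scope ring_scope.

(* The group Z_{d_1} x ... x Z_{d_r}; the factor 'I_(d i).-1.+1 is Z_{d i} as
   soon as d i > 0 (and the trivial group for d i = 0).                       *)
Definition prodZ (r : nat) (d : 'I_r -> nat) :=
  {dffun forall i : 'I_r, 'I_(d i).-1.+1}.

Section ProdZ.
Variables (r : nat) (d : 'I_r -> nat).

HB.instance Definition _ := Finite.on (prodZ d).

Let zero : prodZ d := [ffun i => 0].
Let opp (g : prodZ d) : prodZ d := [ffun i => - g i].
Let add (g h : prodZ d) : prodZ d := [ffun i => g i + h i].

Fact prodZ_addA : associative add.
Proof. by move=> g h k; apply/ffunP => i; rewrite !ffunE addrA. Qed.
Fact prodZ_addC : commutative add.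
Proof. by move=> g h; apply/ffunP => i; rewrite !ffunE addrC. Qed.
Fact prodZ_add0 : left_id zero add.
Proof. by move=> g; apply/ffunP => i; rewrite !ffunE add0r. Qed.
Fact prodZ_addN : left_inverse zero opp add.
Proof. by move=> g; apply/ffunP => i; rewrite !ffunE addNr. Qed.

HB.instance Definition _ := GRing.isZmodule.Build (prodZ d)
  prodZ_addA prodZ_addC prodZ_add0 prodZ_addN.

End ProdZ.

(* The group algebra R[G]: functions G -> R with the convolution product,
   as opposed to the pointwise product that {ffun G -> R} carries.            *)
Definition gralg (R : comNzRingType) (G : finZmodType) := {ffun G -> R}.

Section GroupAlgebra.
Variables (R : comNzRingType) (G : finZmodType).

HB.instance Definition _ := GRing.Zmodule.on (gralg R G).

Definition gralg_delta (S : {set G}) : gralg R G := [ffun g => (g \in S)%:R].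
Definition gralg_conv (a b : gralg R G) : gralg R G :=
  [ffun g => \sum_h a (g - h) * b h].

Fact gralg_convC : commutative gralg_conv.
Proof.
move=> a b; apply/ffunP => g; rewrite !ffunE.
rewrite (reindex_inj (can_inj (subKr g))) /=.
by apply: eq_bigr => h _; rewrite subKr mulrC.
Qed.

Fact gralg_convA : associative gralg_conv.
Proof.
move=> a b c; apply/ffunP => g; rewrite !ffunE.
under eq_bigr => h _ do rewrite ffunE mulr_sumr.
rewrite exchange_big /=; apply: eq_bigr => k _.
rewrite ffunE mulr_suml (reindex_inj (addrI k)) /=.
by apply: eq_bigr => h _; rewrite opprD addrA [k + h - k]addrAC subrr add0r mulrA.
Qed.

Fact gralg_conv1 : left_id (gralg_delta [set 0]) gralg_conv.
Proof.
move=> a; apply/ffunP => g; rewrite ffunE (bigD1 g) //= big1 => [|h hg].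
  by rewrite ffunE subrr inE eqxx mul1r addr0.
by rewrite ffunE inE subr_eq0 eq_sym (negPf hg) mul0r.
Qed.

Fact gralg_convDl : left_distributive gralg_conv +%R.
Proof.
move=> a b c; apply/ffunP => g; rewrite !ffunE -big_split /=.
by apply: eq_bigr => h _; rewrite ffunE mulrDl.
Qed.

Fact gralg_1_neq0 : gralg_delta [set 0] != 0 :> gralg R G.
Proof.
by apply/eqP => /ffunP/(_ 0)/eqP; rewrite !ffunE inE eqxx oner_eq0.
Qed.

HB.instance Definition _ := GRing.Zmodule_isComNzRing.Build (gralg R G)
  gralg_convA gralg_convC gralg_conv1 gralg_convDl gralg_1_neq0.

End GroupAlgebra.

(* Sum of the determinants of all k x k principal submatrices.                *)
Definition beta (R : comNzRingType) (n k : nat) (A : 'M[R]_n) : R :=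
  \sum_(I : {set 'I_n} | #|I| == k) \det (mxsub (@enum_val _ (mem I)) (@enum_val _ (mem I)) A).

(* Number fields inside algC.  All the complex numbers involved are algebraic,
   so algC plays the role of C.                                               *)
Definition numField (s : seq algC) : fieldExtType rat :=
  projT1 (num_field_exists s).
Definition numFieldC (s : seq algC) : {rmorphism numField s -> algC} :=
  projT1 (projT2 (num_field_exists s)).

(* The subfield of algC generated by a subfield K and a set S.                *)
Definition adjoin_subfield (K S : algC -> Prop) (x : algC) : Prop :=
  forall F : {pred algC}, divring_closed F ->
    (forall y, K y -> y \in F) -> (forall y, S y -> y \in F) -> x \in F.

Definition rootsC (p : {poly algC}) : seq algC :=
  sval (closed_field_poly_normal p).

Definition splitField (p : {poly rat}) : fieldExtType rat :=
  numField (rootsC (map_poly ratr p)).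
Definition splitFieldC (p : {poly rat}) : {rmorphism splitField p -> algC} :=
  numFieldC (rootsC (map_poly ratr p)).

Lemma numField_gen (s : seq algC) :
  {s1 : seq (numField s) | map (numFieldC s) s1 = s & <<1 & s1>>%VS = fullv}.
Proof.
rewrite /numFieldC /numField; by case: (num_field_exists s) => L [f []] /= s1; exists s1.
Qed.

Lemma splitFieldP (p : {poly rat}) : p != 0 ->
  splittingFieldFor 1 (map_poly (in_alg (splitField p)) p) {: splitField p}.
Proof.
move=> p0; have [s1 Ds1 gen1] := numField_gen (rootsC (map_poly ratr p)).
exists s1 => //.
rewrite -(eqp_map (splitFieldC p)) -map_poly_comp.
rewrite (eq_map_poly (g := ratr)); last by move=> a; rewrite /= alg_num_field fmorph_rat.
rewrite rmorph_prod /=.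
under eq_bigr => z _ do rewrite rmorphB /= map_polyX map_polyC.
rewrite -(big_map (splitFieldC p) xpredT (fun z => 'X - z%:P)) /=.
rewrite [map _ _]Ds1 /rootsC; case: (closed_field_poly_normal _) => rs /= {1}->.
by rewrite eqp_scale // lead_coef_eq0 map_poly_eq0.
Qed.

(* omega m = e^{2 pi i / m}: by the specification of n.-root, m.-root (-1) is
   the m-th root of -1 of least argument in [0, pi] for m > 1, that is
   e^{pi i / m}; for m = 1, (-1)^2 = 1.                                       *)
Definition omega (m : nat) : algC := m.-root (-1) ^+ 2.

(* omega m is a primitive m-th root of unity: the 2m-th root of unity u != 1
   of largest real part with 'Im u >= 0 generates all the others (a rotation
   by -u would otherwise improve an extremal element of another coset).       *)
Section OmegaPrim.

Let re (x : algC) : algR := in_algR (Creal_Re x).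
Let im (x : algC) : algR := in_algR (Creal_Im x).

Let le_re x y : (re x <= re y) = ('Re x <= 'Re y). Proof. by []. Qed.
Let im_ge0 x : (0 <= im x) = (0 <= 'Im x). Proof. by []. Qed.
Let norm1_re_im x : `|x| = 1 -> re x ^+ 2 + im x ^+ 2 = 1.
Proof.
move=> x1; apply: val_inj; rewrite rmorphD !rmorphXn rmorph1 /=.
by rewrite -normC2_Re_Im x1 expr1n.
Qed.
Let reV x y : `|y| = 1 -> re (x / y) = re x * re y + im x * im y.
Proof.
by move=> y1; apply: val_inj; rewrite rmorphD !rmorphM /= Re_div y1 expr1n divr1.
Qed.
Let imV x y : `|y| = 1 -> im (x / y) = re y * im x - re x * im y.
Proof.
by move=> y1; apply: val_inj; rewrite rmorphB !rmorphM /= Im_div y1 expr1n divr1.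
Qed.
Let eq_re_im x y : re x = re y -> im x = im y -> x = y.
Proof. by move=> /(congr1 val)/= e1 /(congr1 val)/= e2; apply/eqCP. Qed.

Let rot_lemma (c s a b : algR) : 0 <= s -> 0 <= b -> c ^+ 2 + s ^+ 2 = 1 ->
  a ^+ 2 + b ^+ 2 = 1 -> c != 1 -> a <= c ->
  0 <= c * b - a * s /\ a < a * c + b * s.
Proof.
move=> s0 b0 cs ab c1 ac.
have clt1 : c < 1 by rewrite lt_neqAle c1 /=; nra.
have cge : -1 <= c by nra.
have I0 : 0 <= c * b - a * s.
  have [c0|c0] := leP 0 c.
    have [a0|a0] := leP 0 a; last by nra.
    have : s <= b by rewrite -ler_sqr ?nnegrE //; nra.
    by nra.
  have : b <= s by rewrite -ler_sqr ?nnegrE //; nra.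
  by nra.
split=> //.
have [s_0|s_0] := eqVneq s 0.
  have cE : c = -1.
    have : (c - 1) * (c + 1) = 0 by rewrite s_0 in cs; nra.
    by move/eqP; rewrite mulf_eq0 subr_eq0 (negPf c1) /= addr_eq0 => /eqP.
  have aE : a = -1 by apply/eqP; rewrite eq_le; apply/andP; split; nra.
  by rewrite s_0 cE aE; lra.
have sgt : 0 < s by rewrite lt_neqAle eq_sym s_0.
have c1gt : 0 < 1 + c by nra.
have key : (a * c + b * s - a) * (1 + c) = s * (b + (c * b - a * s)).
  have -> : s * (b + (c * b - a * s)) = s * b + s * c * b - a * s ^+ 2 by ring.
  have -> : s ^+ 2 = 1 - c ^+ 2 by rewrite -cs; ring.
  by ring.
have pos : 0 < b + (c * b - a * s).
  have [b_0|b_0] := eqVneq b 0; last first.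
    have : 0 < b by rewrite lt_neqAle eq_sym b_0.
    lra.
  have aE : a = -1.
    have : (a - 1) * (a + 1) = 0 by rewrite b_0 in ab; nra.
    move/eqP; rewrite mulf_eq0 subr_eq0 addr_eq0 => /orP[] /eqP // a1.
    by move: ac; rewrite a1 => /le_lt_trans/(_ clt1); rewrite ltxx.
  by rewrite b_0 aE; lra.
have : 0 < (a * c + b * s - a) * (1 + c) by rewrite key mulr_gt0.
by rewrite pmulr_lgt0 // subr_gt0.
Qed.

Let unit_norm n (x : algC) : (0 < n)%N -> x ^+ n = 1 -> `|x| = 1.
Proof.
move=> n0 xn; apply/eqP; rewrite -(pexpr_eq1 (n := n)) //.
by rewrite -normrX xn normr1.
Qed.

Lemma rootCN1_prim (m : nat) : (0 < m)%N -> (2 * m).-primitive_root (m.-root (-1) : algC).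
Proof.
case: m => [//|[|m]] _.
  have E : 1.-root (-1) = -1 :> algC by rewrite -[LHS]expr1 rootCK.
  rewrite E muln1; apply/andP; split=> //; apply/forallP => -[[|[|]]] //= _; rewrite unity_rootE.
    by rewrite expr1 eqbF_neg -subr_eq0 -opprD oppr_eq0 (pnatr_eq0 algC 2).
  by rewrite eqxx eqb_id sqrrN expr1n.
set M := m.+2; set n := (2 * M)%N; have n0 : (0 < n)%N by [].
have [ze prz] := @C_prim_root_exists n n0.
have zn : ze ^+ n = 1 := prim_expr_order prz.
have zkn k : (ze ^+ k) ^+ n = 1 by rewrite exprAC zn expr1n.
have znorm k : `|ze ^+ k| = 1 by apply: unit_norm (zkn k).
have hM : ze ^+ M = -1.
  have : (ze ^+ M) ^+ 2 == 1 by rewrite -exprM mulnC zn.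
  rewrite sqrf_eq1 => /orP[|/eqP //].
  by rewrite -(prim_order_dvd prz) gtnNdvd // /n mul2n -addnn -addn1 leq_add2l.
pose P (k : 'I_n) := (0 <= im (ze ^+ k)) && (ze ^+ k != 1).
have Mn : (M < n)%N by rewrite /n mul2n -addnn -addn1 leq_add2l.
have Re1 : re (1 : algC) = 1 by apply: val_inj; rewrite /= (Creal_ReP _ _) ?rpred1.
have Pm : P (Ordinal Mn).
  rewrite /P /= hM eqNr oner_eq0 andbT im_ge0 (Creal_ImP _ _) //.
  by rewrite rpredN rpred1.
case: (@arg_maxP _ _ _ (Ordinal Mn) P (fun k : 'I_n => re (ze ^+ k)) Pm) => k0 Pk0 maxk0.
set u := ze ^+ k0 in maxk0.
have /andP[u_im u_1] : (0 <= im u) && (u != 1) := Pk0.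
have un : `|u| = 1 := znorm k0.
have u0 : u != 0 by rewrite -normr_eq0 un oner_eq0.
have umax (x : algC) : x ^+ n = 1 -> 0 <= im x -> x != 1 -> re x <= re u.
  move=> xn x0 x1; have [i xE] := prim_rootP prz xn.
  by rewrite xE; apply: maxk0; rewrite /P -xE x0.
have reu1 : re u != 1.
  apply: contra u_1 => /eqP rE; apply/eqP/eq_re_im; first by rewrite rE Re1.
  have := norm1_re_im un; rewrite rE expr1n => /eqP.
  rewrite -subr_eq0 addrAC subrr add0r expf_eq0 /= => /eqP ->.
  by apply: val_inj; rewrite /= (Creal_ImP _ _) ?rpred1.
(* ze is a power of u *)
have [j zE] : exists j, ze = u ^+ j.
  have [/existsP[j /eqP ->]|no] := boolP [exists j : 'I_n, ze == u ^+ j]; first by exists j.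
  have {}no j : ze != u ^+ j.
    apply: contra no => /eqP E; apply/existsP; exists (inord (j %% n)).
    rewrite inordK ?ltn_mod // E; apply/eqP.
    rewrite {1}(divn_eq j n) exprD mulnC exprM.
    by rewrite (_ : u ^+ n = 1) ?expr1n ?mul1r // /u zkn.
  pose Q (j : 'I_n) := 0 <= im (ze * u ^+ j).
  have [j1 Qj1] : exists j, Q j.
    apply/existsP; apply: contraT => /existsPn neg.
    have s0 : \sum_(j < n) ze * u ^+ j = 0.
      have : (u - 1) * (\sum_(i < n) u ^+ i) = 0 by rewrite -subrX1 /u zkn subrr.
      by move/eqP; rewrite mulf_eq0 subr_eq0 (negPf u_1) /= -mulr_sumr => /eqP ->; rewrite mulr0.
    have imD : {morph im : x y / x + y} by move=> x y; apply: val_inj; rewrite rmorphD /= raddfD.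
    have im0 : im 0 = 0 by apply: val_inj; rewrite /= raddf0.
    have := congr1 im s0; rewrite (big_morph im imD im0) im0 => S0.
    have : \sum_(j < n) im (ze * u ^+ j) < 0.
      rewrite (bigD1 (Ordinal Mn)) //= -[X in _ < X]addr0 ltr_leD //; first by rewrite ltNge; exact: (neg (Ordinal Mn)).
      by apply: sumr_le0 => i _; apply: ltW; rewrite ltNge; exact: (neg i).
    by rewrite S0 ltxx.
  case: (@arg_maxP _ _ _ j1 Q (fun j : 'I_n => re (ze * u ^+ j)) Qj1) => j Qj maxj.
  set y := ze * u ^+ j in maxj.
  have yn : y ^+ n = 1 by rewrite exprMn zn mul1r exprAC /u zkn expr1n.
  have y1 : y != 1.
    apply: contra (no (n * j - j)%N) => /eqP E; apply/eqP.
    apply: (mulIf (expf_neq0 j u0)); rewrite -/y E -exprD subnK ?leq_pmull //.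
    by rewrite exprM /u zkn expr1n.
  have ynorm : `|y| = 1 by apply: unit_norm yn.
  have [] := @rot_lemma (re u) (im u) (re y) (im y) u_im Qj (norm1_re_im un) (norm1_re_im ynorm) reu1 (umax y yn Qj y1).
  rewrite -imV // -reV // => Iy.
  rewrite ltNge => /negP[]; have yuE : exists j' : 'I_n, y / u = ze * u ^+ j'.
    have : (y / u / ze) = u ^+ (j + n.-1).
      apply: (mulIf u0); rewrite -exprSr -addnS prednK // exprD /u zkn mulr1 -/u.
      rewrite mulrAC divfK // /y mulrAC mulfV ?mul1r //.
      by rewrite -normr_eq0 -[ze]expr1 znorm oner_eq0.
    move=> E; exists (inord ((j + n.-1) %% n)); rewrite inordK ?ltn_mod //.
    rewrite expr_mod; last by rewrite /u zkn.
    rewrite -E [RHS]mulrC divfK //.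
    by rewrite -normr_eq0 -[ze]expr1 znorm oner_eq0.
  case: yuE => j' yuE; rewrite yuE; apply: maxj; by rewrite /Q -yuE.
have pru : n.-primitive_root u.
  have [k pruk kn] := prim_order_exists n0 (zkn k0).
  suff -> : n = k by [].
  apply/eqP; rewrite eqn_dvd kn andbT (prim_order_dvd prz).
  by rewrite zE exprAC (prim_expr_order pruk) expr1n.
have uM : u ^+ M = -1.
  have : (u ^+ M) ^+ 2 == 1 by rewrite -exprM mulnC (prim_expr_order pru).
  rewrite sqrf_eq1 => /orP[|/eqP //].
  by rewrite -(prim_order_dvd pru) gtnNdvd.
set z : algC := M.-root (-1).
have zM : z ^+ M = -1 by rewrite rootCK.
have zn' : z ^+ n = 1 by rewrite /n mulnC exprM zM sqrrN expr1n.
have z1 : z != 1.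
  by apply/eqP => E; move/eqP: zM; rewrite E expr1n eq_sym eqNr oner_eq0.
have z_im : 0 <= im z by rewrite im_ge0 Im_rootC_ge0.
suff -> : z = u by [].
have reE : re z = re u.
  apply/eqP; rewrite eq_le umax //= le_re.
  exact: rootC_Re_max.
apply: eq_re_im (reE) _.
have nz := norm1_re_im (unit_norm n0 zn'); have nu := norm1_re_im un.
have : im z ^+ 2 == im u ^+ 2 by rewrite -(inj_eq (addrI (re z ^+ 2))) nz reE nu.
by rewrite eqrXn2 // => /eqP.
Qed.

Lemma omega_prim (m : nat) : (0 < m)%N -> m.-primitive_root (omega m).
Proof.
move=> m0; have := exp_prim_root (rootCN1_prim m0) 2.
by rewrite (gcdn_idPl _) ?dvdn_mulr // mulKn.
Qed.

End OmegaPrim.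

(* Q(omega_N) as a splitting field over Q, so that 'Gal(_ / 1) is available;
   for N = 0 it is Q.                                                         *)
Lemma cyclo_exists (N : nat) :
  {L : splittingFieldType rat & {LC : {rmorphism L -> algC}
    & {w : L | LC w = omega N & <<1; w>>%VS = fullv}}}.
Proof.
have [L [LC [[|w []] // [Dw] genL]]] := num_field_exists [:: omega N].
rewrite span_seq1 in genL.
suff Lax : splitting_field_axiom L.
  have Lmix : FieldExt_isSplittingField _ L by constructor.
  by exists (HB.pack_for (splittingFieldType rat) L Lmix), LC, w.
have [N0|N_gt0] := posnP N.
  have w0 : w = 0.
    by apply: (fmorph_inj LC); rewrite Dw rmorph0 N0 /omega root0C expr0n.
  exists 'X; first exact: polyOverX.
  exists [:: 0]; first by rewrite big_seq1 subr0 eqpxx.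
  by rewrite adjoin_seq1 -w0.
have prw : N.-primitive_root w by rewrite -(fmorph_primitive_root LC) Dw omega_prim.
exists ('X^N - 1); first by rewrite rpredB ?rpred1 ?rpredX //= polyOverX.
pose r := codom (fun i : 'I_N => w ^+ i).
have Dr : 'X^N - 1 = \prod_(y <- r) ('X - y%:P).
  by rewrite -(factor_Xn_sub_1 prw) big_mkord big_image.
exists r; first by rewrite -Dr eqpxx.
apply/eqP; rewrite eqEsubv subvf -genL -adjoin_seq1 adjoin_seqSr //; apply/allP => /=.
by rewrite andbT -root_prod_XsubC -Dr; apply/unity_rootP/prim_expr_order.
Qed.

Definition cycloField (N : nat) : splittingFieldType rat :=
  projT1 (cyclo_exists N).
Definition cycloC (N : nat) : {rmorphism cycloField N -> algC} :=
  projT1 (projT2 (cyclo_exists N)).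
Definition cycloGen (N : nat) : cycloField N :=
  s2val (projT2 (projT2 (cyclo_exists N))).

Lemma cycloGenE (N : nat) : cycloC N (cycloGen N) = omega N.
Proof. exact: (s2valP (projT2 (projT2 (cyclo_exists N)))). Qed.

Lemma cycloGen_gen (N : nat) : <<1; cycloGen N>>%VS = fullv.
Proof. exact: (s2valP' (projT2 (projT2 (cyclo_exists N)))). Qed.

Lemma cycloGen_prim (N : nat) : (0 < N)%N -> N.-primitive_root (cycloGen N).
Proof. by move=> N0; rewrite -(fmorph_primitive_root (cycloC N)) cycloGenE omega_prim. Qed.

Notation cycloGal N := ('Gal({: cycloField N} / 1))%g.

(* The residue l_s modulo N with s(omega_N) = omega_N ^ l_s.                  *)
Definition galExp (N : nat) (s : gal_of {: cycloField N}) : nat :=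
  find (fun l => s (cycloGen N) == cycloGen N ^+ l) (iota 0 N).

Lemma galExpP (N : nat) (s : gal_of {: cycloField N}) : (0 < N)%N ->
  [/\ (galExp s < N)%N, coprime (galExp s) N
    & s (cycloGen N) = cycloGen N ^+ galExp s].
Proof.
move=> N0; have prw := cycloGen_prim N0.
set w := cycloGen N in prw *.
have prsw : N.-primitive_root (s w) by rewrite fmorph_primitive_root.
have [i Di] := prim_rootP prw (prim_expr_order prsw).
have hs : has (fun l => s w == w ^+ l) (iota 0 N).
  by apply/hasP; exists (val i); rewrite ?mem_iota ?Di /=.
have lt : (galExp s < N)%N by move: hs; rewrite has_find size_iota.
have E : s w = w ^+ galExp s.
  by have := nth_find 0%N hs; rewrite nth_iota // => /eqP.
by split=> //; rewrite -(prim_root_exp_coprime _ prw) -E.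
Qed.

(* eta_s: multiplication by l_s in each coordinate.                           *)
Definition eta (r : nat) (d : 'I_r -> nat) (N : nat)
    (s : gal_of {: cycloField N}) (g : prodZ d) : prodZ d :=
  [ffun i => inZp (galExp s * g i)].

Section CayleyDigraph.

(* A digraph is given by its arc relation: there is at most one arc from one
   vertex to another.                                                         *)
Definition adjmx (V : finType) (arc : rel V) : 'M[rat]_#|V| :=
  \matrix_(i, j) (arc (enum_val i) (enum_val j))%:R.

Definition digraph_splitField (V : finType) (arc : rel V) : fieldExtType rat :=
  splitField (char_poly (adjmx arc)).
Definition digraph_splitFieldC (V : finType) (arc : rel V) :
    {rmorphism digraph_splitField arc -> algC} :=
  splitFieldC (char_poly (adjmx arc)).
Definition algdeg (V : finType) (arc : rel V) : nat :=
  \dim {: digraph_splitField arc}.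

Definition in_splitField (V : finType) (arc : rel V) (x : algC) : Prop :=
  exists y, digraph_splitFieldC arc y = x.

Variables (G : finZmodType) (n : nat) (S : 'I_n -> 'I_n -> {set G}).

Definition Cay : rel (G * 'I_n) := fun u w =>
  [exists s in S u.2 w.2, w.1 == s + u.1].

Definition Delta : 'M[gralg rat G]_n :=
  \matrix_(i, j) gralg_delta rat [set - s | s in S j i].

End CayleyDigraph.

Definition fourier (G : finZmodType) (a : gralg algC G) (chi : G -> algC) : algC :=
  \sum_g a g * (chi g)^*.

Definition Delta_hat (G : finZmodType) (n : nat) (S : 'I_n -> 'I_n -> {set G})
    (chi : G -> algC) : 'M[algC]_n :=
  \matrix_(i, j) fourier (gralg_delta algC [set - s | s in S j i]) chi.

Definition chi_ (r : nat) (d : 'I_r -> nat) (v g : prodZ d) : algC :=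
  \prod_i omega (d i) ^+ (v i * g i).

(* The group H and the field K_0 = Inv(H), the latter as a subset of algC.    *)
Definition Hgal (r : nat) (d : 'I_r -> nat) (N n : nat)
    (S : 'I_n -> 'I_n -> {set prodZ d}) : {set gal_of {: cycloField N}} :=
  [set s in cycloGal N | [forall k : 'I_n.+1, (0 < k)%N ==>
    [forall g : prodZ d, beta k (Delta S) g == beta k (Delta S) (eta s g)]]].

Definition InvC (N : nat) (H : {set gal_of {: cycloField N}}) (x : algC) : Prop :=
  exists2 y : cycloField N, y \in fixedField H & cycloC N y = x.

(* Main.v *)
From HB Require Import structures.
Require Import Defs.
From mathcomp Require Import all_boot all_order all_fingroup all_algebra all_field.
From mathcomp Require Import ring.
Import GRing.Theory Num.Theory.
Local Open Scope ring_scope.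

Set Implicit Arguments.
Unset Strict Implicit.
Unset Printing Implicit Defensive.

(* The discrete Fourier transform at chi_v is a ring morphism Q[G] -> C, so it
   sends char_poly Delta, whose coefficients are the beta_k up to sign, to
   P_v = char_poly (Delta_hat chi_v).  An automorphism s of Q(omega_N) sends P_v
   to P_(eta s v), and the transform is injective: hence H is the group of the s
   fixing all the P_v, K0 is generated by their coefficients, and P_v depends
   only on the H-orbit of v.  The eigenvalues of the adjacency matrix are the
   roots of the P_v, an eigenvector y for v giving g |-> chi_v(-g) y.  So the
   splitting field contains K0 and is obtained from it by adjoining the roots of
   |J| polynomials of degree n over K0, at a cost of at most n! for each.      *)

(** * Coefficients of the characteristic polynomial as sums of principal minors *)

Lemma det_mxsub_bij (R : comNzRingType) (m n : nat) (f : 'I_m -> 'I_n)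
    (A : 'M[R]_n) : bijective f -> \det (mxsub f f A) = \det A.
Proof.
move=> fB; have := bij_eq_card fB; rewrite !card_ord => mn.
case: n / mn f A fB => f A /bij_inj fI.
have -> : mxsub f f A = row_perm (perm fI) (col_perm (perm fI) A).
  by apply/matrixP => i j; rewrite !mxE !permE.
rewrite row_permE col_permE !det_mulmx !det_perm odd_permV mulrCA -signr_addb.
by rewrite addbb mulr1.
Qed.

(** Listing [I] before its complement makes the left matrix block upper triangular, with the
    principal submatrix and an identity matrix as diagonal blocks. *)
Lemma det_principal (R : comNzRingType) (n : nat) (I : {set 'I_n}) (A : 'M[R]_n) :
  \det (\matrix_(i, j) (if i \in I then A i j else (i == j)%:R)) =
  \det (mxsub (@enum_val _ (mem I)) (@enum_val _ (mem I)) A).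
Proof.
set B := \matrix_(_, _) _.
pose f (k : 'I_(#|I| + #|~: I|)) := match split k with
  | inl i => @enum_val _ (mem I) i | inr j => @enum_val _ (mem (~: I)) j end.
have Vl (i : 'I_#|I|) : enum_val i \in I := enum_valP i.
have Vr (j : 'I_#|~: I|) : (enum_val j \in I) = false.
  by have := enum_valP j; rewrite inE => /negPf.
have fI : injective f.
  move=> k l; rewrite /f -{2}(splitK k) -{2}(splitK l).
  case: (split k) => i; case: (split l) => j /= E.
  - by rewrite (enum_val_inj E).
  - by have := Vl i; rewrite E Vr.
  - by have := Vl j; rewrite -E Vr.
  - by rewrite (enum_val_inj E).
have fB : bijective f by apply: inj_card_bij => //; rewrite !card_ord cardsC card_ord.
rewrite -(det_mxsub_bij B fB) -(submxK (mxsub f f B)).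
have -> : dlsubmx (mxsub f f B) = 0.
  apply/matrixP => i j; rewrite !mxE /f (unsplitK (inr i)) (unsplitK (inl j)) Vr.
  by case: eqP => // E; have := Vl j; rewrite -E Vr.
have -> : drsubmx (mxsub f f B) = 1%:M.
  apply/matrixP => i j; rewrite !mxE /f (unsplitK (inr i)) (unsplitK (inr j)) Vr.
  by rewrite (inj_eq enum_val_inj).
rewrite det_ublock det1 mulr1; congr (\det _).
by apply/matrixP => i j; rewrite !mxE /f (unsplitK (inl i)) (unsplitK (inl j)) Vl.
Qed.

(** In the Leibniz expansion, each factor is a sum of two terms, and [I] collects the rows where the
    term coming from [A] is chosen. For fixed [I], the sum over permutations is again a determinant,
    computed by [det_principal]. *)
Lemma char_poly_principal (R : comNzRingType) (n : nat) (A : 'M[R]_n) :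
  char_poly A = \sum_(I : {set 'I_n}) (-1) ^+ #|I| *
    (\det (mxsub (@enum_val _ (mem I)) (@enum_val _ (mem I)) A))%:P * 'X^(n - #|I|).
Proof.
pose c (I : {set 'I_n}) (i : 'I_n) : {poly R} := if i \in I then -1 else 'X.
pose B (I : {set 'I_n}) := \matrix_(i, j) (if i \in I then A i j else (i == j)%:R).
have entry (s : 'S_n) (i : 'I_n) : char_poly_mx A i (s i) =
    - (A i (s i))%:P + 'X *+ (i == s i) by rewrite !mxE addrC.
rewrite /char_poly /(\det _).
under eq_bigr => s _.
  under eq_bigr do rewrite entry.
  rewrite bigA_distr mulr_sumr; over.
rewrite exchange_big /=; apply: eq_bigr => I _.
rewrite -det_principal -/(B I) -det_map_mx mulr_sumr mulr_suml.
apply: eq_bigr => s _; rewrite mulrCA -mulrA; congr (_ * _).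
have cE : \prod_i c I i = (-1) ^+ #|I| * 'X^(n - #|I|).
  have -> : (n - #|I|)%N = #|~: I| by rewrite [RHS]cardsCs setCK card_ord.
  rewrite (bigID (mem I)) /= /c -!prodr_const; congr (_ * _).
    by apply: eq_bigr => i ->.
  by apply: eq_big => [i|i /negPf ->]; rewrite ?inE.
rewrite mulrAC -cE -big_split /=; apply: eq_bigr => i _; rewrite /c !mxE.
by case: (i \in I); rewrite ?mulN1r // rmorph_nat mulr_natr.
Qed.

Lemma coef_char_poly_beta (R : comNzRingType) (n k : nat) (A : 'M[R]_n) :
  (k <= n)%N -> (char_poly A)`_(n - k) = (-1) ^+ k * beta k A.
Proof.
move=> kn; rewrite char_poly_principal coef_sum /beta [in RHS]big_mkcond mulr_sumr /=.
apply: eq_bigr => I _; rewrite -mulrA.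
rewrite -[(-1) ^+ _](rmorph_sign polyC) coefCM coefMXn.
(* With this bound the truncated subtraction loses nothing, so the exponent [n - k] selects exactly
   the sets of size [k]. *)
have In : (#|I| <= n)%N by rewrite -[X in (_ <= X)%N]card_ord max_card.
case: (ltngtP #|I| k) => [Ik|Ik|<-]; last by rewrite ltnn subnn coefC eqxx.
  by rewrite ltn_sub2lE // Ik !mulr0.
by rewrite ltn_sub2lE // ltnNge (ltnW Ik) coefC subn_eq0 leq_sub2lE // leqNgt Ik !mulr0.
Qed.

(** * Degree bounds for adjoining all roots of split polynomials *)

Lemma dim_adjoin_roots (F0 : fieldType) (E : fieldExtType F0) (rs : seq E)
    (F : {subfield E}) : \prod_(x <- rs) ('X - x%:P) \is a polyOver F ->
  (\dim <<F & rs>> <= (size rs)`! * \dim F)%N.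
Proof.
elim: rs F => [|r rs IHrs] F; first by rewrite Fadjoin_nil mul1n.
set p := \prod_(_ <- _) _ => Fp.
(* The remaining roots are adjoined over F(r), which contains the coefficients of the quotient of
   [p] by X - r. *)
have Fr_rs : \prod_(x <- rs) ('X - x%:P) \is a polyOver <<F; r>>%VS.
  have <- : p %/ ('X - r%:P) = \prod_(x <- rs) ('X - x%:P).
    by rewrite /p big_cons mulKp // polyXsubC_eq0.
  rewrite divp_polyOver //; first exact: polyOverS (subvP (subv_adjoin F r)) p Fp.
  by rewrite polyOverXsubC memv_adjoin.
have deg_r : (adjoin_degree F r <= (size rs).+1)%N.
  have p0 : p != 0 by rewrite monic_neq0 // monic_prod_XsubC.
  have pr : root p r by rewrite root_prod_XsubC mem_head.
  have := dvdp_leq p0 (minPoly_dvdp Fp pr).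
  by rewrite size_minPoly size_prod_XsubC.
rewrite adjoin_cons; apply: leq_trans (IHrs _ Fr_rs) _.
by rewrite dim_Fadjoin mulnA factS [(_.+1 * _)%N]mulnC !leq_mul.
Qed.

(** The lists are adjoined one after the other. The polynomial of a later list is still defined over
    the enlarged field, so each list costs a factor of at most n!. *)
Lemma dim_adjoin_roots_flatten (F0 : fieldType) (E : fieldExtType F0) (n : nat)
    (rss : seq (seq E)) (F : {subfield E}) :
  {in rss, forall rs, size rs = n /\ \prod_(x <- rs) ('X - x%:P) \is a polyOver F} ->
  (\dim <<F & flatten rss>> <= n`! ^ size rss * \dim F)%N.
Proof.
elim: rss F => [|rs rss IHrss] F Frss; first by rewrite Fadjoin_nil mul1n.
have [rs_n Frs] := Frss rs (mem_head _ _).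
have le_cat : (<<F & rs ++ flatten rss>> <= <<<<F & rs>> & flatten rss>>)%VS.
  apply/Fadjoin_seqP; split=> [|x]; first by rewrite (subv_trans (subv_adjoin_seq F rs)) ?subv_adjoin_seq.
  rewrite mem_cat => /orP[] x_s; last exact: seqv_sub_adjoin.
  exact: subvP (subv_adjoin_seq _ _) _ (seqv_sub_adjoin _ x_s).
apply: leq_trans (leq_trans (dimvS le_cat) (IHrss _ _)) _ => [rs' rss'|].
  have [-> Frs'] : size rs' = n /\ _ := Frss rs' (@mem_behead _ (rs :: rss) _ rss'); split=> //.
  exact: polyOverS (subvP (subv_adjoin_seq F rs)) _ Frs'.
by rewrite expnSr -mulnA leq_mul // -rs_n dim_adjoin_roots.
Qed.

(** * Number fields, their complex images, and the degree of the cyclotomic field *)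

Section NumberFields.

Variables (L : fieldExtType rat) (f : {rmorphism L -> algC}).

(** The image of [f], given as the rational span of a basis in order to be a boolean predicate:
    [adjoin_subfield] quantifies over such predicates. *)
Definition fieldImage : {pred algC} := Crat_span (map f (vbasis {:L})).

Lemma fieldImageP x : reflect (exists y, f y = x) (x \in fieldImage).
Proof.
apply: (iffP (Crat_spanP _ _)) => [[a ->]|[y <-]].
  exists (\sum_i a i *: (vbasis {:L})`_i); rewrite rmorph_sum; apply: eq_bigr => i _.
  by rewrite rmorphZ_num (nth_map 0) // -(size_map f).
apply/Crat_spanP; rewrite (coord_vbasis (memvf y)) rmorph_sum.
rewrite rpred_sum // => i _; rewrite rmorphZ_num Crat_spanZ //.
by rewrite mem_Crat_span // map_f // mem_nth // size_tuple.
Qed.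

Lemma fieldImage_divring : divring_closed fieldImage.
Proof.
split=> [|_ _ /fieldImageP[x <-] /fieldImageP[y <-]|_ _ /fieldImageP[x <-] /fieldImageP[y <-]].
- by apply/fieldImageP; exists 1; rewrite rmorph1.
- by apply/fieldImageP; exists (x - y); rewrite rmorphB.
- by apply/fieldImageP; exists (x / y); rewrite fmorph_div.
Qed.

Variables (F : {pred algC}) (F_divring : divring_closed F).

Lemma divring_closed_rat (a : rat) : ratr a \in F.
Proof.
pose F' : divringClosed algC := HB.pack F (GRing.isDivringClosed.Build _ F F_divring).
exact: (rpred_rat F').
Qed.

(** Elements of K(r) are polynomials in r over K. This links adjunction inside [L] to the closed
    sets of complex numbers used by [adjoin_subfield]. *)
Lemma adjoin_seq_closed (s : seq L) (K : {subfield L}) :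
    {in K, forall x, f x \in F} -> {in s, forall x, f x \in F} ->
  {in <<K & s>>%VS, forall x, f x \in F}.
Proof.
pose F' : divringClosed algC := HB.pack F (GRing.isDivringClosed.Build _ F F_divring).
elim: s K => [|r s IHs] K FK Fs; first by rewrite Fadjoin_nil.
rewrite adjoin_cons; apply: IHs => [x|x sx]; last by rewrite Fs // mem_behead.
case/Fadjoin_polyP => p /polyOverP Kp ->; rewrite horner_coef rmorph_sum /=.
apply: (@rpred_sum _ F') => i _; rewrite rmorphM rmorphXn.
by apply: (@rpredM _ F'); [exact: FK | apply: (@rpredX _ F'); exact: Fs (mem_head _ _)].
Qed.

End NumberFields.

(** Used to copy K0 from the cyclotomic field into the splitting field, where degrees over it can be
    counted. A left inverse of [f2] carries a basis of [K] to a free family with the same complex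
    values, whose span is closed under products. *)
Lemma subfield_transport (L1 L2 : fieldExtType rat) (f1 : {rmorphism L1 -> algC})
    (f2 : {rmorphism L2 -> algC}) (K : {subfield L1}) :
    {in K, forall x, f1 x \in fieldImage f2} ->
  exists2 K2 : {subfield L2}, \dim K2 = \dim K &
    forall y, y \in K2 <-> exists2 x, x \in K & f2 y = f1 x.
Proof.
move=> im_K; have [h _ hK] := num_field_proj f2.
pose g x := h (f1 x).
have gE x : x \in K -> f2 (g x) = f1 x.
  by move=> /im_K /fieldImageP[y Dy]; rewrite /g -Dy hK.
pose b := vbasis K; pose c := map_tuple g b.
have bK i : b`_i \in K.
  have [i_lt|i_ge] := ltnP i (\dim K); first by rewrite vbasis_mem // mem_nth // size_tuple.
  by rewrite nth_default ?mem0v // size_tuple.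
have cE (a : 'I_(\dim K) -> rat) : f2 (\sum_i a i *: c`_i) = f1 (\sum_i a i *: b`_i).
  rewrite !rmorph_sum; apply: eq_bigr => i _.
  by rewrite !rmorphZ_num (nth_map 0) ?size_tuple // gE.
have spanK (a : 'I_(\dim K) -> rat) : \sum_i a i *: b`_i \in K by apply: memv_suml => i _; rewrite memvZ.
pose V := <<c>>%VS.
have VP y : reflect (exists2 x, x \in K & f2 y = f1 x) (y \in V).
  apply: (iffP idP) => [/coord_span ->|[x /coord_vbasis -> Dy]].
    by rewrite cE; eexists; last reflexivity.
  suff -> : y = \sum_i coord b i x *: c`_i.
    by apply: memv_suml => i _; rewrite memvZ // memv_span // mem_nth // size_tuple.
  by apply: (fmorph_inj f2); rewrite cE.
have Vas : is_aspace V.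
  apply/andP; split.
    by apply: has_algid1; apply/VP; exists 1; rewrite ?mem1v // !rmorph1.
  apply/prodvP => y z /VP[x Kx Dx] /VP[t Kt Dt]; apply/VP.
  by exists (x * t); rewrite ?memvM // !rmorphM Dx Dt.
exists (ASpace Vas) => [|y]; last by split=> /VP.
suff /eqP -> : free c by rewrite size_tuple.
apply/freeP => a /(congr1 f2); rewrite cE rmorph0 => /eqP.
rewrite fmorph_eq0 => /eqP; exact: (freeP (basis_free (vbasisP K))).
Qed.

(** The minimal polynomial of [cycloGen N] inside the abstract field and that of [omega N] in [algC]
    come from rational polynomials dividing each other; the latter is the cyclotomic polynomial. *)
Lemma dim_cycloField (N : nat) : (0 < N)%N -> \dim {:cycloField N} = totient N.
Proof.
move=> N0; rewrite -(cycloGen_gen N) dim_Fadjoin dimv1 muln1.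
apply: succn_inj; rewrite -size_minPoly -size_Cyclotomic.
set w := cycloGen N; have prw := cycloGen_prim N0.
have prz : N.-primitive_root (omega N) := omega_prim N0.
have <- : size (minCpoly (omega N)) = size 'Phi_N.
  rewrite (minCpoly_cyclotomic prz) -(Cintr_Cyclotomic prz) size_map_inj_poly //.
  exact: intr_inj.
have [q [-> qmon] qP] := minCpolyP (omega N).
have /polyOver1P[p Dp] := minPolyOver 1 w.
have toC (t : {poly rat}) : map_poly (cycloC N) (map_poly (in_alg _) t) = map_poly ratr t.
  rewrite -map_poly_comp; apply: eq_map_poly => a.
  by rewrite /= alg_num_field fmorph_rat.
have rootE (t : {poly rat}) : root (map_poly (in_alg _) t) w = (q %| t).
  by rewrite -qP -cycloGenE -toC fmorph_root.
rewrite Dp !size_map_poly; apply: eqp_size.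
apply/andP; split; last by rewrite -rootE -Dp root_minPoly.
rewrite -(dvdp_map (in_alg (cycloField N))) -Dp minPoly_dvdp ?alg_polyOver //.
by rewrite rootE dvdpp.
Qed.

(** * Characters of G and the discrete Fourier transform *)

Section Characters.

Variables (r : nat) (d : 'I_r -> nat).
Hypothesis d_gt0 : forall i, (0 < d i)%N.
Notation G := (prodZ d).
Notation N := (\prod_i d i)%N.
Implicit Types (u v g h : G).

Lemma prod_d_gt0 : (0 < N)%N.
Proof. by rewrite prodn_gt0. Qed.

Lemma chi_sym v g : chi_ v g = chi_ g v.
Proof. by apply: eq_bigr => i _; rewrite mulnC. Qed.

Lemma omega_mul_mod i k m :
  omega (d i) ^+ (k * (m %% (d i).-1.+1)) = omega (d i) ^+ (k * m).
Proof.
have om1 : omega (d i) ^+ d i = 1 by rewrite prim_expr_order // omega_prim.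
by rewrite prednK // -(expr_mod _ om1) modnMmr (expr_mod _ om1).
Qed.

Lemma chi_addr v g h : chi_ v (g + h) = chi_ v g * chi_ v h.
Proof.
rewrite -big_split; apply: eq_bigr => i _ /=.
by rewrite ffunE omega_mul_mod mulnDr exprD.
Qed.

Lemma chi_0r v : chi_ v 0 = 1.
Proof. by rewrite /chi_ big1 // => i _; rewrite ffunE muln0 expr0. Qed.

Lemma chi_unity v g : chi_ v g ^+ N = 1.
Proof.
rewrite -prodrXl big1 // => i _.
have omN : omega (d i) ^+ N = 1.
  by rewrite (bigD1 i) //= exprM (prim_expr_order (omega_prim (d_gt0 i))) expr1n.
by rewrite -exprM mulnC exprM omN expr1n.
Qed.

Lemma chi_neq0 v g : chi_ v g != 0.
Proof.
by have := oner_neq0 algC; rewrite -(chi_unity v g) expf_eq0 prod_d_gt0.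
Qed.

Lemma chi_oppr v g : chi_ v (- g) = (chi_ v g)^-1.
Proof.
by apply: (mulfI (chi_neq0 v g)); rewrite -chi_addr subrr chi_0r divff ?chi_neq0.
Qed.

Lemma chi_conj v g : (chi_ v g)^* = chi_ v (- g).
Proof.
rewrite chi_oppr invC_norm.
suff -> : `|chi_ v g| = 1 by rewrite expr1n invr1 mul1r.
apply/eqP; rewrite -(pexpr_eq1 (n := N)) ?prod_d_gt0 //.
by rewrite -normrX chi_unity normr1.
Qed.

Lemma chi_nondegenerate g : (forall v, chi_ v g = 1) -> g = 0.
Proof.
move=> g1; apply/ffunP => i; rewrite ffunE; apply/val_inj => /=.
have gi : (g i < d i)%N by apply: leq_trans (ltn_ord (g i)) _; rewrite prednK.
(* The i-th unit vector: pairing [g] with it leaves [omega (d i) ^+ g i], so [d i] divides [g i],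
   which is smaller. *)
pose v : G := [ffun j => inZp (j == i)].
have := g1 v; rewrite /chi_ (bigD1 i) //= big1 => [|j /negPf ji]; last first.
  by rewrite ffunE ji /= mod0n mul0n expr0.
rewrite mulr1 ffunE eqxx mulnC omega_mul_mod muln1 => /eqP.
rewrite -(prim_order_dvd (omega_prim (d_gt0 i))).
by case: (nat_of_ord (g i)) gi => // k k_lt; rewrite gtnNdvd.
Qed.

(** Translating the summation index by [u] multiplies the sum by [chi_ u g]; for nonzero [g] some
    [u] makes this factor differ from 1. *)
Lemma chi_orthogonal g : \sum_v chi_ v g = if g == 0 then #|G|%:R else 0.
Proof.
case: eqP => [->|/eqP g0].
  by under eq_bigr do rewrite chi_0r; rewrite sumr_const.
have [u u1] : exists u, chi_ u g != 1.
  apply/existsP; apply: contraNT g0 => /existsPn g1.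
  by apply/eqP/chi_nondegenerate => v; apply/eqP; rewrite -[_ == _]negbK g1.
have : (chi_ u g - 1) * (\sum_v chi_ v g) = 0.
  rewrite mulrBl mul1r [X in _ - X](reindex_inj (addrI u)) /= mulr_sumr -sumrB.
  by apply: big1 => v _; rewrite chi_sym !(chi_sym _ g) chi_addr subrr.
by move/eqP; rewrite mulf_eq0 subr_eq0 (negPf u1) => /eqP.
Qed.

(** Fourier inversion: summing the transform against [chi_ v (- h)] over [v] leaves [#|G|] times
    [a h]. *)
Lemma fourier_inj (a : G -> algC) :
  (forall v, \sum_g a g * chi_ v g = 0) -> forall g, a g = 0.
Proof.
move=> a0 h; have : \sum_v chi_ v (- h) * \sum_g a g * chi_ v g = 0.
  by apply: big1 => v _; rewrite a0 mulr0.
under eq_bigr do rewrite mulr_sumr.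
rewrite exchange_big (bigD1 h) //= [X in _ + X]big1 => [|g gh]; last first.
  under eq_bigr do rewrite mulrCA -chi_addr.
  by rewrite -mulr_sumr chi_orthogonal addrC subr_eq0 (negPf gh) mulr0.
under eq_bigr do rewrite mulrCA -chi_addr.
rewrite -mulr_sumr chi_orthogonal addNr eqxx addr0 => /eqP.
rewrite mulf_eq0 pnatr_eq0 => /orP[/eqP //|]; rewrite -leqn0 leqNgt.
by rewrite (cardD1 0).
Qed.

(** The transform [fourier] at [chi_ v] for rational coefficients, with the conjugate written as
    [chi_ v (- g)] in accordance with [chi_conj]. *)
Definition hat v (a : gralg rat G) : algC := \sum_g ratr (a g) * chi_ v (- g).

Lemma hat_zmod_morphism v : zmod_morphism (hat v).
Proof.
move=> a b; rewrite /hat -sumrB; apply: eq_bigr => g _.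
by rewrite !ffunE rmorphB mulrBl.
Qed.

Lemma hat_monoid_morphism v : monoid_morphism (hat v).
Proof.
split=> [|a b].
  rewrite /hat (bigD1 0) //= big1 => [|g g0].
    by rewrite ffunE inE eqxx rmorph1 oppr0 chi_0r mulr1 addr0.
  by rewrite ffunE inE (negPf g0) rmorph_nat mul0r.
rewrite /hat mulr_sumr.
under eq_bigr => g _ do rewrite ffunE rmorph_sum mulr_suml.
rewrite exchange_big; apply: eq_bigr => h _ /=.
rewrite (reindex_inj (addIr h)) mulr_suml /=; apply: eq_bigr => g _.
by rewrite addrK rmorphM opprD chi_addr mulrACA.
Qed.

HB.instance Definition _ v := GRing.isZmodMorphism.Build (gralg rat G) algC (hat v)
  (hat_zmod_morphism v).
HB.instance Definition _ v := GRing.isMonoidMorphism.Build (gralg rat G) algC (hat v)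
  (hat_monoid_morphism v).

Lemma hat_inj (a b : gralg rat G) : (forall v, hat v a = hat v b) -> a = b.
Proof.
move=> ab; pose c g : algC := ratr (a (- g)) - ratr (b (- g)).
have c0 : forall g, c g = 0.
  apply: fourier_inj => v; rewrite (reindex_inj oppr_inj) /=.
  under eq_bigr do rewrite /c opprK mulrBl.
  by rewrite sumrB; apply/eqP; rewrite subr_eq0; apply/eqP/ab.
apply/ffunP => g; apply: (fmorph_inj (@ratr algC)).
by apply/eqP; rewrite -subr_eq0 -[g]opprK; apply/eqP/c0.
Qed.

(** * Galois action on characters and transforms *)

Section Galois.

Variable s : gal_of {: cycloField N}.

Lemma gal_unity (x : cycloField N) : x ^+ N = 1 -> s x = x ^+ galExp s.
Proof.
have [_ _ sw] := galExpP s prod_d_gt0.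
move=> /(prim_rootP (cycloGen_prim prod_d_gt0))[k ->].
by rewrite rmorphXn /= sw exprAC.
Qed.

Lemma chi_etar v g : chi_ v (eta s g) = chi_ v g ^+ galExp s.
Proof.
rewrite /chi_ -prodrXl; apply: eq_bigr => i _; rewrite ffunE omega_mul_mod.
by rewrite mulnCA mulnC exprM.
Qed.

Lemma chi_etal v g : chi_ (eta s v) g = chi_ v g ^+ galExp s.
Proof. by rewrite chi_sym chi_etar chi_sym. Qed.

(** An automorphism acts on the abstract field and not on [algC], so its effect on a complex value
    is stated through a preimage [y]. *)
Lemma cycloC_chi v g : exists2 y, cycloC N y = chi_ v g & cycloC N (s y) = chi_ (eta s v) g.
Proof.
have prw := cycloGen_prim prod_d_gt0.
have [k Dk] := prim_rootP (omega_prim prod_d_gt0) (chi_unity v g).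
exists (cycloGen N ^+ k); first by rewrite rmorphXn cycloGenE Dk.
rewrite gal_unity; last by rewrite exprAC (prim_expr_order prw) expr1n.
by rewrite !rmorphXn cycloGenE -Dk chi_etal.
Qed.

Lemma cycloC_hat v a : exists2 y, cycloC N y = hat v a & cycloC N (s y) = hat (eta s v) a.
Proof.
(* [cycloC_chi] asserts mere existence; the left inverse [C'] of [cycloC] turns the preimages into a
   function of [g]. *)
have y_ g : {y | cycloC N y = chi_ v (- g) & cycloC N (s y) = chi_ (eta s v) (- g)}.
  have [C' _ CK] := num_field_proj (cycloC N).
  exists (C' (chi_ v (- g))); have [y <- Dsy] := cycloC_chi v (- g); first by rewrite CK.
  by rewrite CK.
exists (\sum_g a g *: s2val (y_ g)); rewrite ?linear_sum rmorph_sum; apply: eq_bigr => g _.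
  by rewrite rmorphZ_num (s2valP (y_ g)).
by rewrite linearZ rmorphZ_num (s2valP' (y_ g)).
Qed.

(** If g and h have the same image, then [s] takes equal values on their characters; [s] is
    injective, so the characters agree and nondegeneracy applies. *)
Lemma eta_inj : injective (@eta r d N s).
Proof.
move=> g h gh; apply/eqP; rewrite -subr_eq0; apply/eqP/chi_nondegenerate => v.
rewrite chi_addr chi_oppr; suff -> : chi_ v g = chi_ v h by rewrite divff ?chi_neq0.
rewrite chi_sym [RHS]chi_sym.
have [x Dx Dsx] := cycloC_chi g v; have [y Dy Dsy] := cycloC_chi h v.
rewrite -Dx -Dy; congr (cycloC N _); apply: (fmorph_inj s).
by apply: (fmorph_inj (cycloC N)); rewrite Dsx Dsy gh.
Qed.

(** The map [eta s] is self-adjoint for the pairing [chi_]: on either side it raises the value to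
    the power [galExp s]. *)
Lemma hat_eta v (a : gralg rat G) : hat (eta s v) [ffun g => a (eta s g)] = hat v a.
Proof.
rewrite /hat [RHS](reindex_inj eta_inj) /=; apply: eq_bigr => g _.
by rewrite ffunE chi_etal !chi_oppr chi_etar exprVn.
Qed.

(** This translates the condition defining H into one on transforms. The converse uses [hat_inj] and
    the surjectivity of [eta s] on the finite group. *)
Lemma eta_invariantP (a : gralg rat G) :
  (forall g, a g = a (eta s g)) <-> (forall v, hat (eta s v) a = hat v a).
Proof.
split=> [a_s v|a_s].
  by rewrite -[RHS]hat_eta; congr hat; apply/ffunP => g; rewrite ffunE.
have [eta' _ etaK] := injF_bij eta_inj.
have aE : [ffun g => a (eta s g)] = a :> gralg rat G.
  by apply: hat_inj => v; rewrite -[v]etaK hat_eta a_s.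
by move=> g; rewrite -[in LHS]aE ffunE.
Qed.

End Galois.

End Characters.

(** * Spectrum of the Cayley digraph *)

Lemma char_poly_tr (R : comNzRingType) (n : nat) (A : 'M[R]_n) :
  char_poly A^T = char_poly A.
Proof.
rewrite /char_poly -det_tr; congr (\det _); apply/matrixP => i j.
by rewrite !mxE eq_sym.
Qed.

Lemma mem_rootsC (p : {poly algC}) x : p != 0 -> (x \in rootsC p) = root p x.
Proof.
rewrite /rootsC; case: (closed_field_poly_normal p) => rs /= pE p0.
by rewrite [in RHS]pE rootZ ?root_prod_XsubC // lead_coef_eq0.
Qed.

(** Left eigenvectors become functions on the vertices, which hides the enumeration behind
    [adjmx]. *)
Lemma eigenvalue_adjmxP (V : finType) (arc : rel V) (a : algC) :
  reflect (exists2 y : V -> algC, exists u, y u != 0 &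
             forall w, \sum_u y u * (arc u w)%:R = a * y w)
    (root (map_poly ratr (char_poly (adjmx arc))) a).
Proof.
rewrite map_char_poly -eigenvalue_root_char.
set A := map_mx ratr _; have AE (x : 'rV_#|V|) w :
    (x *m A) 0 (enum_rank w) = \sum_u x 0 (enum_rank u) * (arc u w)%:R.
  rewrite mxE (reindex (@enum_rank V)) /=; last first.
    by apply: onW_bij; apply: enum_rank_bij.
  by apply: eq_bigr => u _; rewrite !mxE !enum_rankK rmorph_nat.
apply: (iffP eigenvalueP) => [[x xA /rV0Pn[i xi]]|[y [u yu] yA]].
  exists (fun u => x 0 (enum_rank u)); first by exists (enum_val i); rewrite enum_valK.
  by move=> w; rewrite -AE xA mxE.
exists (\row_i y (enum_val i)); last first.
  by apply/rV0Pn; exists (enum_rank u); rewrite mxE enum_rankK.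
apply/rowP => i; rewrite -[i]enum_valK AE !mxE enum_rankK -yA.
by apply: eq_bigr => w _; rewrite mxE enum_rankK.
Qed.

Section CayleySpectrum.

Variables (r : nat) (d : 'I_r -> nat).
Hypothesis d_gt0 : forall i, (0 < d i)%N.
Notation G := (prodZ d).
Notation N := (\prod_i d i)%N.
Variables (n : nat) (S : 'I_n -> 'I_n -> {set G}).
Implicit Types (u v g h : G).

Notation P v := (char_poly (Delta_hat S (chi_ v))).

Lemma mem_opp_set (X : {set G}) g : (g \in [set - s | s in X]) = (- g \in X).
Proof. by rewrite -{1}[g]opprK mem_imset //; apply: oppr_inj. Qed.

(** The sign in -S cancels the conjugation in [fourier]. *)
Lemma Delta_hatE v i j :
  Delta_hat S (chi_ v) i j = \sum_g (g \in S j i)%:R * chi_ v g.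
Proof.
rewrite mxE /fourier (reindex_inj oppr_inj); apply: eq_bigr => g _ /=.
by rewrite ffunE mem_opp_set chi_conj // opprK.
Qed.

Lemma map_hat_Delta v : map_mx (hat v) (Delta S) = Delta_hat S (chi_ v).
Proof.
apply/matrixP => i j; rewrite Delta_hatE !mxE /hat (reindex_inj oppr_inj) /=.
by apply: eq_bigr => g _; rewrite ffunE mem_opp_set !opprK rmorph_nat.
Qed.

Lemma char_poly_Delta_hat v : P v = map_poly (hat v) (char_poly (Delta S)).
Proof. by rewrite map_char_poly map_hat_Delta. Qed.

Lemma CayE (u w : G * 'I_n) : Cay S u w = (w.1 - u.1 \in S u.2 w.2).
Proof.
apply/exists_inP/idP => [[s sS /eqP ->]|]; first by rewrite addrK.
by exists (w.1 - u.1); rewrite // subrK.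
Qed.

Lemma root_char_poly_Cay (a : algC) :
  root (map_poly ratr (char_poly (adjmx (Cay S)))) a <-> exists v, root (P v) a.
Proof.
(* Entry (i, j) of [Delta_hat] involves [S j i]; after transposition its left eigenvectors follow
   the direction of the arcs, as those of [adjmx] do. *)
have rootP v : root (P v) a <-> exists2 y : 'I_n -> algC, exists i, y i != 0 &
    forall j, \sum_i y i * (\sum_g (g \in S i j)%:R * chi_ v g) = a * y j.
  rewrite -char_poly_tr -eigenvalue_root_char; split=> [/eigenvalueP|[y [i yi] yD]].
    case=> x xD /rV0Pn[i xi]; exists (fun i => x 0 i); first by exists i.
    move=> j; have /rowP/(_ j) := xD; rewrite !mxE => <-.
    by apply: eq_bigr => k _; rewrite [in RHS]mxE Delta_hatE.
  apply/eigenvalueP; exists (\row_i y i); last by apply/rV0Pn; exists i; rewrite mxE.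
  apply/rowP => j; rewrite !mxE -yD.
  by apply: eq_bigr => k _; rewrite mxE [(_^T) _ _]mxE Delta_hatE.
split=> [/eigenvalue_adjmxP[x [[g i] xgi] xA]|[v /rootP[y [i yi] yD]]].
  (* The Fourier transform of [x] in its group coordinate; by injectivity it is nonzero at [i] for
     some [v]. *)
  pose y v j := \sum_h x (h, j) * chi_ v h.
  have [v yv] : exists v, y v i != 0.
    apply/existsP; apply: contraNT xgi => /existsPn y0.
    apply/eqP; apply: (fourier_inj d_gt0 (a := fun g => x (g, i))) => v.
    by apply/eqP; rewrite -[_ == _]negbK y0.
  exists v; apply/rootP; exists (y v) => [|j]; first by exists i.
  rewrite mulr_sumr; transitivity (\sum_k \sum_h \sum_g0
      x (h, k) * chi_ v (g0 + h) * (g0 \in S k j)%:R).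
    apply: eq_bigr => k _; rewrite mulr_suml; apply: eq_bigr => h _.
    rewrite mulr_sumr; apply: eq_bigr => g0 _.
    by rewrite chi_addr //; ring.
  (* Shifting [g0] by [h] replaces the connection element by the head of the arc leaving (h, k). *)
  transitivity (\sum_k \sum_h \sum_g0
      x (h, k) * chi_ v g0 * (Cay S (h, k) (g0, j))%:R).
    apply: eq_bigr => k _; apply: eq_bigr => h _; rewrite [RHS](reindex_inj (addIr h)).
    by apply: eq_bigr => g0 _; rewrite CayE /= addrK.
  under eq_bigr do rewrite exchange_big.
  rewrite exchange_big; apply: eq_bigr => g0 _ /=.
  rewrite mulrA -xA mulr_suml exchange_big pair_big /=.
  by apply: eq_bigr => -[h k] _ /=; rewrite mulrAC.
apply/eigenvalue_adjmxP; exists (fun w => chi_ v (- w.1) * y w.2).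
  by exists (0, i) => /=; rewrite mulf_neq0 // chi_neq0.
move=> [h j] /=; rewrite mulrCA -yD mulr_sumr.
rewrite -(pair_bigA _ (fun g k => chi_ v (- g) * y k * (Cay S (g, k) (h, j))%:R)) /=.
rewrite exchange_big; apply: eq_bigr => k _ /=.
(* The substitution of h - g for g replaces the tail of the arc by its connection element. *)
rewrite (reindex_inj (inj_comp (addrI h) oppr_inj)) !mulr_sumr.
apply: eq_bigr => g _ /=; rewrite CayE /= opprD opprK addrA subrr add0r.
by rewrite chi_addr //; ring.
Qed.

End CayleySpectrum.

(** * H as the Galois group over the field of coefficients *)

Section HGalois.

Variables (r : nat) (d : 'I_r -> nat).
Hypothesis d_gt0 : forall i, (0 < d i)%N.
Notation G := (prodZ d).
Notation N := (\prod_i d i)%N.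
Variables (n : nat) (S : 'I_n -> 'I_n -> {set G}).
Implicit Types (u v g h : G).

Notation L := (cycloField N).
Notation P v := (char_poly (Delta_hat S (chi_ v))).

Lemma coef_char_poly_eta (s : gal_of {:L}) v i (y : L) :
  cycloC N y = (P v)`_i -> cycloC N (s y) = (P (eta s v))`_i.
Proof.
rewrite !char_poly_Delta_hat // !coef_map /= => Dy.
have [z Dz <-] := cycloC_hat d_gt0 s v (char_poly (Delta S))`_i.
by congr (cycloC N (s _)); apply: (fmorph_inj (cycloC N)); rewrite Dy Dz.
Qed.

Lemma cycloC_coef_char_poly v i : exists y : L, cycloC N y = (P v)`_i.
Proof.
rewrite char_poly_Delta_hat // coef_map.
by have [y Dy _] := cycloC_hat d_gt0 1%g v (char_poly (Delta S))`_i; exists y.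
Qed.

Lemma mem_gal1 (s : gal_of {:L}) : s \in ('Gal({:L} / 1))%g.
Proof. by rewrite -sub1set galois_connection ?subvf // sub1v. Qed.

Lemma mem_HgalP (s : gal_of {:L}) :
  reflect (forall v, P (eta s v) = P v) (s \in Hgal N S).
Proof.
rewrite inE mem_gal1 /=.
apply: (iffP forallP) => [beta_s v|P_s k].
  apply/polyP => i; have [i_n|n_i|->] := ltngtP i n.
  - have k_gt0 : (0 < n - i)%N by rewrite subn_gt0.
    have k_lt : (n - i < n.+1)%N by rewrite ltnS leq_subr.
    have := beta_s (Ordinal k_lt); rewrite k_gt0 /= => /forallP beta_k.
    rewrite !char_poly_Delta_hat // !coef_map /=.
    have -> : i = (n - (n - i))%N by rewrite subKn // ltnW.
    rewrite coef_char_poly_beta ?leq_subr // !rmorphM !rmorph_sign; congr (_ * _).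
    have /(eta_invariantP d_gt0) hat_beta g : beta (n - i) (Delta S) g =
      beta (n - i) (Delta S) (eta s g) by apply/eqP.
    exact: hat_beta.
  - by rewrite !nth_default // size_char_poly.
  (* Degree n corresponds to k = 0, which [Hgal] excludes; monicity settles it. *)
  - have lead u : (P u)`_n = 1.
      by have /monicP := char_poly_monic (Delta_hat S (chi_ u)); rewrite /lead_coef size_char_poly.
    by rewrite !lead.
apply/implyP => k_gt0; apply/forallP => g; apply/eqP; move: g.
have kn : (k <= n)%N by rewrite -ltnS.
apply/(eta_invariantP d_gt0) => v; have /(congr1 (fun p : {poly _} => p`_(n - k))) := P_s v.
rewrite !char_poly_Delta_hat // !coef_map /= coef_char_poly_beta // !rmorphM !rmorph_sign.
by apply: mulfI; rewrite signr_eq0.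
Qed.

Lemma galois_cyclo (K : {subfield L}) : galois K {:L}.
Proof.
apply: (@galoisS _ _ 1%AS); first by rewrite sub1v subvf.
apply/and3P; split; [exact: sub1v | | exact: normalFieldf].
apply/separableP => y _; apply: pcharf0_separable; exact: ftrans (pchar_lalg _) (pchar_num _).
Qed.

(** [K1] is generated over the rationals by the coefficients of all the [P v], so fixing [K1] means
    fixing these polynomials. The last clause serves to place [K1] inside the splitting field. *)
Lemma Hgal_galois : exists K1 : {subfield L},
  [/\ ('Gal({:L} / K1))%g = Hgal N S,
      forall v i, exists2 y, y \in K1 & cycloC N y = (P v)`_i
    & forall F : {pred algC}, divring_closed F -> (forall v i, (P v)`_i \in F) ->
        {in K1, forall x, cycloC N x \in F}].
Proof.
have [C' _ CK] := num_field_proj (cycloC N).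
have C'K v i : cycloC N (C' (P v)`_i) = (P v)`_i.
  by have [y <-] := cycloC_coef_char_poly v i; rewrite CK.
pose cs := [seq C' (P v)`_i | v <- enum {: G}, i <- iota 0 n.+1].
have cs_mem v (i : nat) : (i <= n)%N -> C' (P v)`_i \in cs.
  by move=> i_n; apply/allpairsP; exists (v, i); rewrite mem_enum mem_iota.
have cs_fix (s : gal_of {:L}) : reflect (forall v, P (eta s v) = P v)
    (all (fun y => s y == y) cs).
  apply: (iffP allP) => [fix_s v|P_s _ /allpairsP[[v i] [_ _ ->]]]; last first.
    apply/eqP/(fmorph_inj (cycloC N)).
    by rewrite (coef_char_poly_eta s (C'K v i)) P_s C'K.
  apply/polyP => i; have [i_n|n_i] := leqP i n; last by rewrite !nth_default // size_char_poly.
  rewrite -(coef_char_poly_eta s (C'K v i)) -[RHS]C'K; congr (cycloC N _).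
  exact/eqP/fix_s/cs_mem.
exists <<1 & cs>>%AS; split=> [|v i|F F_div F_P].
- apply/setP => s; rewrite (sameP (mem_HgalP s) (cs_fix s)).
  rewrite -sub1set galois_connection ?subvf //.
  apply/Fadjoin_seqP/allP => [[_ fix_s] y /fix_s|fix_s].
    by move/mem_fixedFieldP => [_ /(_ s (set11 _)) /eqP].
  split=> [|y /fix_s /eqP sy]; first exact: sub1v.
  by apply/fixedFieldP; rewrite ?memvf // => t /set1P ->.
- have [i_n|n_i] := leqP i n; last first.
    by exists 0; rewrite ?mem0v // rmorph0 nth_default // size_char_poly.
  by exists (C' (P v)`_i); rewrite ?C'K // seqv_sub_adjoin ?cs_mem.
- apply: adjoin_seq_closed => // [x|x /allpairsP[[v i] [_ _ ->]]]; last by rewrite C'K.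
  by case/vlineP => a ->; rewrite alg_num_field fmorph_rat divring_closed_rat.
Qed.

End HGalois.

(** * Splitting field and degree bounds *)

Theorem theorem3p4 (r : nat) (d : 'I_r -> nat) (d_gt0 : forall i, (0 < d i)%N)
    (n : nat) (S : 'I_n -> 'I_n -> {set prodZ d})
    (J : finType) (Horb : J -> {set prodZ d}) (v : J -> prodZ d) :
  let N := (\prod_i d i)%N in
  let H := Hgal N S in
  (* the Horb j are the distinct orbits of G under H *)
  injective Horb ->
  (forall O : {set prodZ d},
     (exists j, Horb j = O) <-> (exists g, O = [set eta s g | s in H])) ->
  (forall j, v j \in Horb j) ->
  (forall x : algC,
     in_splitField (Cay S) x <->
     adjoin_subfield (InvC H)
       (fun y => exists j, root (char_poly (Delta_hat S (chi_ (v j)))) y) x)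
  /\ (totient N)%:R / #|H|%:R <= (algdeg (Cay S))%:R :> rat
  /\ (algdeg (Cay S))%:R <=
       (n`! ^ #|J|)%:R * ((totient N)%:R / #|H|%:R) :> rat.
Proof.
move=> N H _ Horb_orbit v_Horb.
have N_gt0 : (0 < N)%N := prod_d_gt0 d_gt0.
pose P u := char_poly (Delta_hat S (chi_ u)).
have [K1 [galK1 P_K1 K1_sub]] := Hgal_galois d_gt0 S.
have InvH : fixedField H = K1 by rewrite /H -galK1; apply/galois_fixedField/galois_cyclo.
have dim_K1 : (totient N = #|H| * \dim K1)%N.
  by rewrite -dim_cycloField // (dim_sup_field (subvf K1)) galois_dim ?galois_cyclo // galK1.
have H_gt0 : (0 < #|H|)%N by rewrite /H -galK1 cardG_gt0.
(* The orbit of [u] is some [Horb j], so [v j] is [eta s u] with [s] in H, and such an [s] preserves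
   [P u]. *)
have repr u : exists j, P u = P (v j).
  have [j Dj] : exists j, Horb j = [set eta s u | s in H] by apply/Horb_orbit; exists u.
  have := v_Horb j; rewrite Dj => /imsetP[s sH Ds].
  by exists j; rewrite Ds /P (mem_HgalP d_gt0 S s sH).
set chi := char_poly (adjmx (Cay S)).
pose chiC : {poly algC} := map_poly ratr chi.
pose E := digraph_splitField (Cay S); pose toC := digraph_splitFieldC (Cay S).
have root_chi a : root chiC a <-> exists u, root (P u) a by apply: root_char_poly_Cay.
have [s1 Ds1 gen_s1] : {s1 : seq E | map toC s1 = rootsC chiC & <<1 & s1>>%VS = fullv}.
  exact: numField_gen.
have mem_s1 y : (y \in s1) = root chiC (toC y).
  rewrite -mem_rootsC -?Ds1 ?mem_map //; first exact: fmorph_inj.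
  by rewrite map_poly_eq0 monic_neq0 // char_poly_monic.
(* [Q u] lists the roots of [P u] in [E] with multiplicity, pulled back by [h]; they have preimages
   because they are eigenvalues of the digraph. *)
have [Q [sizeQ PQ]] : exists Q : prodZ d -> seq E,
    (forall u, size (Q u) = n) /\ (forall u, P u = map_poly toC (\prod_(x <- Q u) ('X - x%:P))).
  have [h _ hK] := num_field_proj toC.
  have split_P u : P u = \prod_(z <- rootsC (P u)) ('X - z%:P).
    rewrite /rootsC; case: (closed_field_poly_normal _) => rs /= {1}->.
    by rewrite (monicP (char_poly_monic _)) scale1r.
  exists (fun u => map h (rootsC (P u))); split=> u.
    apply: succn_inj; rewrite size_map -(size_char_poly (Delta_hat S (chi_ u))).
    by rewrite -/(P u) [in RHS]split_P size_prod_XsubC.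
  rewrite rmorph_prod big_map {1}split_P; apply: eq_big_seq => z /= z_P.
  rewrite rmorphB /= map_polyX map_polyC /=.
  have /mapP[y _ ->] : z \in map toC s1.
    rewrite Ds1 mem_rootsC; last by rewrite map_poly_eq0 monic_neq0 // char_poly_monic.
    by apply/root_chi; exists u; rewrite split_P root_prod_XsubC.
  by rewrite hK.
have rootQ u y : root (P u) (toC y) = (y \in Q u).
  by rewrite PQ fmorph_root root_prod_XsubC.
have P_im u i : (P u)`_i \in fieldImage toC.
  by apply/fieldImageP; rewrite PQ coef_map; eexists.
(* The coefficients of the [P u] are polynomials in their roots, hence come from [E]; so does the
   field they generate, and [K] is its copy in [E]. *)
have K1_im := K1_sub _ (fieldImage_divring toC) P_im.
have [K dimK memK] := subfield_transport K1_im.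
have E_gen : <<K & flatten [seq Q (v j) | j <- enum J]>>%VS = fullv.
  apply/eqP; rewrite eqEsubv subvf -gen_s1; apply/Fadjoin_seqP; split=> [|y].
    exact: sub1v.
  rewrite mem_s1 => /root_chi[u]; have [j ->] := repr u; rewrite rootQ => Qy.
  apply: seqv_sub_adjoin; apply/flatten_mapP; exists j => //.
  by rewrite mem_enum.
have QK u : \prod_(x <- Q u) ('X - x%:P) \is a polyOver K.
  apply/polyOverP => i; apply/memK; have [x K1x Dx] := P_K1 u i.
  by exists x; rewrite // Dx -/(P u) PQ coef_map.
split; first split=> [[y <-] F F_div K0F rootF | x_adj].
(* [E] is generated by the eigenvalues [s1], each a root of some [P u] and thus of some
   [P (v j)]. *)
- have Ey : y \in <<1%AS & s1>>%VS by rewrite gen_s1 memvf.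
  apply: (adjoin_seq_closed F_div _ _ Ey) => [_ /vlineP[a ->]|z].
    by rewrite alg_num_field fmorph_rat divring_closed_rat.
  rewrite mem_s1 => /root_chi[u]; have [j Pu] := repr u => Puz.
  by apply: rootF; exists j; rewrite -/(P (v j)) -Pu.
(* The image of [E] is itself one of the closed sets over which [adjoin_subfield] quantifies. *)
- apply/fieldImageP; apply: x_adj; first exact: fieldImage_divring.
    by move=> _ [y yH <-]; apply: K1_im; rewrite -InvH.
  move=> a [j Pa]; have : a \in map toC s1; last by case/mapP => y _ ->; apply/fieldImageP; exists y.
  rewrite Ds1 mem_rootsC; last by rewrite map_poly_eq0 monic_neq0 // char_poly_monic.
  by apply/root_chi; exists (v j).
(* The quotient is the degree of K0, so the lower bound says that [E] contains [K], and the upper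
   one bounds the adjunction of [#|J|] lists of n roots. *)
have -> : (totient N)%:R / #|H|%:R = (\dim K)%:R :> rat.
  by rewrite dimK dim_K1 natrM mulrC mulKf // pnatr_eq0 -lt0n.
rewrite -natrM !ler_nat; split; first exact: dimvS (subvf K).
rewrite /algdeg -/E -E_gen [in X in (_ <= X)%N]cardE -(size_map (fun j => Q (v j))).
by apply: dim_adjoin_roots_flatten => _ /mapP[j _ ->].
Qed.
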